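(* Let $X$ be a Banach space and let $C\subset X$ be a bounded, closed and convex subset with more than one element. Let $\mathcal{M}$ be the set of all non-expansive mappings $f\colon C\to C$, equipped with the metric $d(f,g)=\sup_{x\in C}\|f(x)-g(x)\|$. Then the set $\mathcal{N}=\{f\in\mathcal{M}: \operatorname{Lip}(f)<1\}$ of all strict contractions is a $\sigma$-porous subset of $\mathcal{M}$.
   Context: For $f\colon C\to C$, $\operatorname{Lip}(f)=\sup\{\|f(y)-f(z)\|/\|y-z\| : y,z\in C,\ y\neq z\}$; $f$ is non-expansive if $\operatorname{Lip}(f)\le 1$ and a strict contraction if $\operatorname{Lip}(f)<1$. Porosity: let $(P,d)$ be a non-empty metric space and $B(x,r)$ the open ball with centre $x$ and radius $r$. A subset $A\subset P$ is porous at $x\in A$ if there are constants $\alpha>0$ and $\varepsilon_0>0$ such that for all $\varepsilon\in(0,\varepsilon_0)$ there is a point $y\in P$ with $d(y,x)\le\varepsilon$ and $B(y,\alpha\varepsilon)\cap A=\emptyset$. $A$ is porous if it is porous at all of its points. A set $F\subset P$ is $\sigma$-porous if it is a countable union of porous sets. *)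

(* Defs.v *)
From HB Require Import structures.
From mathcomp Require Import all_boot all_order all_algebra.
From mathcomp Require Import all_classical all_reals all_analysis.

Set Implicit Arguments.
Unset Strict Implicit.
Unset Printing Implicit Defensive.

Import Order.TTheory GRing.Theory Num.Theory.
Import numFieldNormedType.Exports.

Local Open Scope classical_set_scope.
Local Open Scope ring_scope.

Section porosity.
Context {R : realType} {P : metricType R}.
Implicit Types (A F : set P) (x : P).

Definition porous_at A x : Prop :=
  exists alpha eps0 : R, [/\ 0 < alpha, 0 < eps0 &
    forall eps, 0 < eps -> eps < eps0 ->
      exists y : P, mdist y x <= eps /\ ball y (alpha * eps) `&` A = set0].

Definition porous A : Prop := forall x, A x -> porous_at A x.

(* The empty set is porous, so finite unions are covered by sequences. *)
Definition sigma_porous F : Prop :=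
  exists2 A : nat -> set P, (forall n, porous (A n)) & F = \bigcup_n A n.

End porosity.

Section nonexpansive.
Context {R : realType} {X : normedModType R}.

(* A set [C : set X] coerces to the type [{x : X | x \in C}] of its points.
   The supremum is extended-real, as the quotients of an arbitrary self-map
   may be unbounded. *)
Definition Lip (C : set X) (f : C -> C) : \bar R :=
  ereal_sup [set r | exists y z : C,
    y <> z /\ r = (`|val (f y) - val (f z)| / `|val y - val z|)%:E].

(* The boundedness of C is a parameter of the type because it is what makes
   the uniform distance below a metric. *)
Definition nonexp_maps (C : set X) (bC : bounded_set C) : Type :=
  {f : C -> C | (Lip f <= 1)%E}.

End nonexpansive.

Section nonexp_metric.
Context {R : realType} {X : normedModType R} (C : set X) (bC : bounded_set C).
Implicit Types f g h : nonexp_maps bC.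

HB.instance Definition _ := gen_eqMixin (nonexp_maps bC).
HB.instance Definition _ := gen_choiceMixin (nonexp_maps bC).

Definition unif_dist f g : R :=
  sup [set `|val (val f x) - val (val g x)| | x in [set: C]].

Let unif_dist_ub f g x : `|val (val f x) - val (val g x)| <= unif_dist f g.
Proof.
apply: ub_le_sup; last by exists x.
have [M [_ /(_ (M + 1))]] := bC; rewrite ltrDl => /(_ ltr01) CM.
exists (M + 1 + (M + 1)) => _ [y _ <-].
rewrite (le_trans (ler_normB _ _))// lerD//; apply: CM; apply: set_mem.
  exact: (valP (val f y)).
exact: (valP (val g y)).
Qed.

Let unif_dist_le f g (M : R) : 0 <= M ->
  (forall x, `|val (val f x) - val (val g x)| <= M) -> unif_dist f g <= M.
Proof.
move=> M0 fgM; rewrite /unif_dist.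
have [->|ne] := eqVneq [set `|val (val f x) - val (val g x)| | x in [set: C]]
  set0; first by rewrite sup0.
by apply: ge_sup; [exact/set0P | move=> _ [x _ <-]; exact: fgM].
Qed.

Let unif_dist_ge0 f g : 0 <= unif_dist f g.
Proof.
have [[x _]|C0] := pselect ([set: C] !=set0).
  exact: le_trans (unif_dist_ub f g x).
rewrite /unif_dist; have -> : [set: C] = set0.
  by apply/seteqP; split => // x _; apply: C0; exists x.
by rewrite image_set0 sup0.
Qed.

Let unif_distxx f : unif_dist f f = 0.
Proof.
apply/le_anti; rewrite unif_dist_ge0 andbT; apply: unif_dist_le => // x.
by rewrite subrr normr0.
Qed.

Let unif_dist_positivity f g : unif_dist f g = 0 -> f = g.
Proof.
move=> fg0; apply: val_inj; apply/funext => x; apply: val_inj.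
apply/eqP; rewrite -subr_eq0 -normr_le0 -fg0; exact: unif_dist_ub.
Qed.

Let unif_dist_sym f g : unif_dist f g = unif_dist g f.
Proof.
rewrite /unif_dist; congr (sup _).
by apply/seteqP; split => _ [x _ <-]; exists x => //; rewrite distrC.
Qed.

Let unif_dist_triangle g f h :
  unif_dist f h <= unif_dist f g + unif_dist g h.
Proof.
apply: unif_dist_le => [|x]; first by rewrite addr_ge0.
by rewrite (le_trans (ler_distD (val (val g x)) _ _))// lerD.
Qed.

HB.instance Definition _ := isMetric.Build R (nonexp_maps bC)
  unif_distxx unif_dist_positivity unif_dist_sym unif_dist_triangle.

End nonexp_metric.

(* Main.v *)
(* The strict contractions split into the countably many bands a < Lip f <= b,
   with a and b rational and so close that b < a (1 + d) while
   b (1 + 2 d) <= 1, and the constant maps.  Given f in a band and a small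
   scale e, bisection of a segment on which f has slope > a yields p, q, w in C
   with q the midpoint of p and w, of mutual distance comparable to e, such
   that f still has slope > a between p and q.  Pulling the points near the
   segment towards w, with a weight given by a tent function, is a
   (1 + 2 d)-Lipschitz self-map phi of C that moves points by at most e and
   stretches a subsegment of [p, q] onto [p, q] by the factor 1 + d.  Then
   f \o phi is non-expansive, is e-close to f, and has slope > a (1 + d) > b at
   scale e, so no map of the band lies in a ball around it of radius
   proportional to e.  Near a constant map f one uses (1 - t) f + t id. *)
Require Import Defs.
From HB Require Import structures.
From mathcomp Require Import all_boot all_order all_algebra.
From mathcomp Require Import all_classical all_reals all_analysis.
From mathcomp Require Import ring lra.

Set Implicit Arguments.
Unset Strict Implicit.
Unset Printing Implicit Defensive.

Import Order.TTheory GRing.Theory Num.Theory.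
Import numFieldNormedType.Exports.

Local Open Scope classical_set_scope.
Local Open Scope ring_scope.

(** * Lipschitz constants, steep segments and the stretching map *)

Section Lipschitz.
Context {R : realType} {X : normedModType R} (C : set X).
Implicit Types (f : C -> C) (a b e : R).

Lemma norm_sub_gt0 (x y : C) : x <> y -> 0 < `|val x - val y|.
Proof.
by move=> xy; rewrite normr_gt0 subr_eq0; apply/eqP => /val_inj.
Qed.

Lemma Lip_leP f b : (Lip f <= b%:E)%E <->
  forall x y, `|val (f x) - val (f y)| <= b * `|val x - val y|.
Proof.
split=> [fb x y|fb].
  have [->|xy] := pselect (x = y); first by rewrite !subrr normr0 mulr0.
  rewrite -ler_pdivrMr ?norm_sub_gt0// -lee_fin; apply: le_trans fb.
  by apply: ereal_sup_ubound; exists x, y.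
apply: ge_ereal_sup => _ [x [y [xy ->]]].
by rewrite lee_fin ler_pdivrMr ?norm_sub_gt0.
Qed.

Lemma Lip_gt_witness f a : (a%:E < Lip f)%E ->
  exists x y, a * `|val x - val y| < `|val (f x) - val (f y)|.
Proof.
move=> /ereal_sup_gt[_ [x [y [xy ->]]]].
by rewrite lte_fin ltr_pdivlMr ?norm_sub_gt0// => ?; exists x, y.
Qed.

Context (cvC : convex_set (C : set (convex_lmodType X))).

Lemma convex_point (x y : C) (t : R) : 0 <= t <= 1 ->
  exists z : C, val z = val x + t *: (val y - val x).
Proof.
move=> /andP[t0 t1].
have t1' : 0 <= 1 - t <= 1 by lra.
have /andP[s0 s1] := t1'.
pose l := Itv01 s0 s1.
have zC := cvC l (valP x) (valP y).
exists (SigSub zC); rewrite /conv/= unstable.onemK scalerBl scale1r scalerBr.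
by rewrite -addrA [in RHS](addrC (t *: _)).
Qed.

(** By the triangle inequality at the midpoint, the two halves cannot both have slope at most [a].
    The steep half becomes [p], [q], and [w] is the far end of the other half. *)
Lemma steep_half f a (x y : C) :
  a * `|val x - val y| < `|val (f x) - val (f y)| ->
  exists p q w : C, [/\ val w - val q = val q - val p,
    `|val q - val p| = `|val x - val y| / 2 &
    a * `|val q - val p| < `|val (f q) - val (f p)|].
Proof.
move=> fxy; have [|m mE] := @convex_point x y (1 / 2); first lra.
have hx : val m - val x = 2^-1 *: (val y - val x).
  by rewrite mE addrC addKr div1r.
have hy : val y - val m = 2^-1 *: (val y - val x).
  rewrite -[val y - val m](subrKA (val x)) -[val x - val m]opprB hx.
  rewrite -[X in X - _]scale1r -scalerBl; congr (_ *: _).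
  by field.
have nx : `|val m - val x| = `|val x - val y| / 2.
  by rewrite hx normrZ gtr0_norm ?invr_gt0// mulrC distrC.
have ny : `|val m - val y| = `|val x - val y| / 2.
  by rewrite distrC hy normrZ gtr0_norm ?invr_gt0// mulrC distrC.
have [mx|mx] := ltP (a * `|val m - val x|) `|val (f m) - val (f x)|.
  by exists x, m, y; rewrite hx hy -hx.
exists y, m, x; split=> //.
  by rewrite -opprB hx -hy opprB.
rewrite ltNge; apply/negP => my; move: fxy; apply/negP; rewrite -leNgt.
rewrite (le_trans (ler_distD (val (f m)) _ _))//.
rewrite (distrC (val (f x))) (le_trans (lerD mx my))// -mulrDr nx ny.
by rewrite -splitr.
Qed.

(** Bisection stops at the first length at most [e]; the segment just halved had length at least
    [e], whence the lower bound [e / 2]. *)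
Lemma steep_at_scale f a e (x y : C) : 0 < e -> e <= `|val x - val y| ->
  a * `|val x - val y| < `|val (f x) - val (f y)| ->
  exists p q w : C, [/\ val w - val q = val q - val p,
    e / 2 <= `|val q - val p| <= e &
    a * `|val q - val p| < `|val (f q) - val (f p)|].
Proof.
move=> e0.
have [n xyn] : exists n, `|val x - val y| < e * 2 ^+ n.
  exists (Num.bound (`|val x - val y| / e)).
  by rewrite mulrC -ltr_pdivrMr// upper_nthrootP.
elim: n x y xyn => [|n IHn] x y xyn exy fxy; first by move: xyn; lra.
have [p [q [w [pqw pqxy fpq]]]] := steep_half fxy.
have [pqe|epq] := leP `|val q - val p| e.
  by exists p, q, w; split=> //; lra.
apply: IHn fpq; last exact: ltW.
by move: xyn; rewrite pqxy exprS; lra.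
Qed.

(** Since the pull aims at [w], beyond [q], a weight of order [d] suffices to carry [x0] to [q], and
    the Lipschitz constant exceeds 1 only by an amount of that order. *)
Lemma tent_map (p q w : C) (d : R) : 0 < d -> p <> q ->
  val w - val q = val q - val p ->
  exists (phi : C -> C) (x0 : C), [/\ phi x0 = q, phi p = p,
    `|val q - val p| = (1 + d) * `|val x0 - val p|,
    (forall x y, `|val (phi x) - val (phi y)| <=
                 (1 + 2 * d) * `|val x - val y|) &
    forall x, `|val (phi x) - val x| <= `|val q - val p|].
Proof.
move=> d0 pq wq; set l := `|val q - val p|.
have l0 : 0 < l by apply: norm_sub_gt0 => /esym.
have d1 : 0 < 1 + d by lra.
have d2 : 0 < 1 + 2 * d by lra.
pose rho := l / (1 + d).
have rho0 : 0 < rho by rewrite divr_gt0.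
have lrho : l = (1 + d) * rho by rewrite /rho; field; rewrite gt_eqF.
have [|x0 x0E] := @convex_point p q (1 + d)^-1.
  by rewrite invr_ge0 ltW//= invf_le1//; lra.
have x0p : val x0 - val p = (1 + d)^-1 *: (val q - val p).
  by rewrite x0E addrC addKr.
have nx0p : `|val x0 - val p| = rho.
  by rewrite x0p normrZ gtr0_norm ?invr_gt0// mulrC.
(* s is the weight for which (1 - s) x0 + s w = q. *)
pose s := d / (1 + 2 * d).
have s0 : 0 < s by rewrite divr_gt0.
have sE : s * (1 + 2 * d) = d by rewrite /s; field; rewrite gt_eqF.
have s1 : s <= 1 by rewrite ler_pdivrMr//; lra.
(* [c] is the slope of the tent [sigma], of height [s] at [x0] and zero from distance [rho] on, in
   particular at [p]. *)
pose c := s / rho.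
have c0 : 0 < c by rewrite divr_gt0.
have crho : c * rho = s by rewrite /c; field; rewrite gt_eqF.
pose sigma (x : C) : R := c * Num.max 0 (rho - `|val x - val x0|).
have sigma_ge0 x : 0 <= sigma x by rewrite mulr_ge0 ?(ltW c0)// le_max lexx.
have sigma_le x : sigma x <= s.
  by rewrite -crho ler_pM2l// ge_max (ltW rho0) lerBlDr lerDl/=.
have sigma_out x : rho <= `|val x - val x0| -> sigma x = 0.
  by move=> h; rewrite /sigma max_l ?mulr0// subr_le0.
have wx0 : val w - val x0 = ((1 + 2 * d) / (1 + d)) *: (val q - val p).
  rewrite -[LHS](subrKA (val q)) wq -[val q - val x0](subrKA (val p)).
  rewrite -[val p - val x0]opprB x0p -{1 2}[val q - val p]scale1r.
  rewrite -scalerBl -scalerDl; congr (_ *: _).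
  by field; rewrite gt_eqF.
have nw (x : C) : `|val x - val x0| <= rho -> `|val w - val x| <= 2 * l.
  move=> xr; rewrite (le_trans (ler_distD (val x0) _ _))// wx0 normrZ.
  rewrite (distrC (val x0)) gtr0_norm ?divr_gt0// -/l.
  have -> : (1 + 2 * d) / (1 + d) * l = 2 * l - rho.
    by rewrite /rho; field; rewrite gt_eqF.
  by lra.
have phiP x : exists z : C,
    val z = val x + sigma x *: (val w - val x).
  by apply: convex_point; rewrite sigma_ge0/= (le_trans (sigma_le x)).
have [phi phiE] := choice phiP.
exists phi, x0; split.
- apply: val_inj; rewrite phiE.
  have -> : sigma x0 = s.
    by rewrite /sigma subrr normr0 subr0 max_r ?crho// ltW.
  rewrite wx0 scalerA; apply: (@addIr _ (- val p)).
  rewrite addrAC x0p -scalerDl -[RHS]scale1r; congr (_ *: _).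
  by rewrite /s; field; rewrite !gt_eqF.
- by apply: val_inj; rewrite phiE sigma_out ?scale0r ?addr0// distrC nx0p.
- by rewrite nx0p.
- have sigma_lip x y : `|sigma x - sigma y| <= c * `|val x - val y|.
    rewrite /sigma -mulrBr normrM (gtr0_norm c0) ler_pM2l//.
    have := ler_dist_dist (val x - val x0) (val y - val x0).
    rewrite opprB addrA subrK.
    rewrite !ler_norml => /andP[h1 h2].
    by rewrite /Num.max; case: ifPn; case: ifPn; rewrite -?leNgt => *; lra.
  (* As x and y play symmetric roles, the bound on |w - y| is only needed at
     whichever of the two lies in the support of the tent. *)
  move=> x y; wlog yr : x y / `|val y - val x0| <= rho.
    move=> ih; have [yr|yr] := leP `|val y - val x0| rho; first exact: ih.
    have [xr|xr] := leP `|val x - val x0| rho.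
      by rewrite distrC (distrC (val x)); exact: ih.
    rewrite !phiE (sigma_out _ (ltW xr)) (sigma_out _ (ltW yr)) !scale0r !addr0.
    by rewrite ler_peMl//; lra.
  (* The first term does not expand, as [0 <= sigma x <= 1]; the excess over 1 comes only from the
     slope of [sigma] times the distance to [w]. *)
  have -> : val (phi x) - val (phi y) =
      (1 - sigma x) *: (val x - val y) + (sigma x - sigma y) *: (val w - val y).
    rewrite !phiE opprD addrACA scalerBl scale1r -[RHS]addrA; congr (_ + _).
    rewrite -[val w - val x](subrKA (val y)) scalerDr -(opprB (val x)) scalerN.
    by rewrite scalerBl addrAC addrC.
  rewrite (le_trans (ler_normD _ _))// !normrZ ger0_norm; last first.
    by rewrite subr_ge0 (le_trans (sigma_le x)).
  have h1 : (1 - sigma x) * `|val x - val y| <= `|val x - val y|.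
    by rewrite ler_piMl// lerBlDr lerDl.
  have h2 := ler_pM (normr_ge0 _) (normr_ge0 _) (sigma_lip x y) (nw _ yr).
  rewrite (le_trans (lerD h1 h2))//.
  (* As [l = (1 + d) * rho], the product is [2 * s * (1 + d)], at most
     [2 * s * (1 + 2 * d) = 2 * d]. *)
  have cl : c * (2 * l) <= 2 * d.
    have -> : c * (2 * l) = 2 * (s * (1 + d)) by rewrite lrho -crho; ring.
    by move: sE; nra.
  by have := ler_wpM2r (normr_ge0 (val x - val y)) cl; lra.
- move=> x; have -> : val (phi x) - val x = sigma x *: (val w - val x).
    by rewrite phiE addrC addKr.
  rewrite normrZ ger0_norm//.
  have [xr|xr] := leP `|val x - val x0| rho; last first.
    by rewrite sigma_out ?mul0r ?ltW.
  (* Here [2 * s = 2 * d / (1 + 2 * d)] is below 1, so the displacement is at most [l]. *)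
  rewrite (le_trans (ler_pM _ _ (sigma_le x) (nw _ xr)))//.
  by move: sE l0; nra.
Qed.

End Lipschitz.

(** * Porosity of the bands and of the constant maps *)

Section nonexpansive_maps.
Context {R : realType} {X : normedModType R} (C : set X) (bC : bounded_set C).
Implicit Types f g h : nonexp_maps bC.

Lemma nonexp_norm_le f (x y : C) :
  `|val (val f x) - val (val f y)| <= `|val x - val y|.
Proof. by have /Lip_leP/(_ x y) := valP f; rewrite mul1r. Qed.

Lemma norm_le_mdist f g (x : C) :
  `|val (val f x) - val (val g x)| <= mdist f g.
Proof.
apply: ub_le_sup; last by exists x.
have [M [_ /(_ (M + 1))]] := bC; rewrite ltrDl => /(_ ltr01) CM.
exists (M + 1 + (M + 1)) => _ [y _ <-].
by rewrite (le_trans (ler_normB _ _))// lerD//; apply: CM; apply: set_mem;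
  apply: valP.
Qed.

Lemma mdist_le f g (M : R) (x0 : C) :
  (forall x, `|val (val f x) - val (val g x)| <= M) -> mdist f g <= M.
Proof.
move=> fgM; apply: ge_sup; last by move=> _ [x _ <-].
by exists `|val (val f x0) - val (val g x0)|, x0.
Qed.

(** Used to exclude [h] from a ball: it cannot lie there once [g] separates [x] and [y] by at least
    [2 * r] more than [h] does. *)
Lemma ball_norm_le g h (r : R) (x y : C) : ball g r h ->
  `|val (val g x) - val (val g y)| < `|val (val h x) - val (val h y)| + 2 * r.
Proof.
rewrite ballEmdist/= => gh.
have hx := le_lt_trans (norm_le_mdist g h x) gh.
have hy := le_lt_trans (norm_le_mdist g h y) gh.
have := ler_distD (val (val h x)) (val (val g x)) (val (val g y)).
have := ler_distD (val (val h y)) (val (val h x)) (val (val g y)).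
by rewrite (distrC (val (val h y)) (val (val g y))); lra.
Qed.

Context (cvC : convex_set (C : set (convex_lmodType X))).

Lemma porous_Lip_band (a b d : R) :
  0 < d -> b * (1 + 2 * d) <= 1 -> b < a * (1 + d) ->
  porous [set f : nonexp_maps bC | (a%:E < Lip (val f))%E /\
                                   (Lip (val f) <= b%:E)%E].
Proof.
move=> d0 bd ba f /= [/Lip_gt_witness[x [y fxy]] /Lip_leP fb].
have xy0 : 0 < `|val x - val y|.
  by apply: norm_sub_gt0 => xy; move: fxy; rewrite xy !subrr normr0 mulr0 ltxx.
have b0 : 0 <= b.
  by rewrite -(pmulr_lge0 _ xy0) (le_trans _ (fb x y)).
pose gap := a * (1 + d) - b.
have gap0 : 0 < gap by rewrite subr_gt0.
(* Between [x0] and [p] the new map exceeds the bound for the band by [gap * |x0 - p|], where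
   [|x0 - p| >= e / 2 / (1 + d)]; a ball of radius [r] tolerates only [2 * r]. Bisection needs
   [e <= |x - y|]. *)
exists (gap / (1 + d) / 4), `|val x - val y|; split=> //.
  by rewrite !divr_gt0//; lra.
move=> e e0 exy.
have [p [q [w [pqw /andP[eq qe] fpq]]]] := steep_at_scale cvC e0 (ltW exy) fxy.
have pq : p <> q.
  by move=> pq; move: fpq; rewrite pq !subrr normr0 mulr0 ltxx.
have [phi [x0 [phix0 phip pqx0 phi_lip phi_near]]] := tent_map cvC d0 pq pqw.
have gP : (Lip (val f \o phi) <= 1)%E.
  apply/Lip_leP => u v /=; rewrite (le_trans (fb _ _))//.
  rewrite (le_trans (ler_wpM2l b0 (phi_lip u v)))// mulrA.
  by rewrite ler_wpM2r.
pose g : nonexp_maps bC := exist _ (val f \o phi) gP.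
exists g; split.
  apply: (mdist_le x) => u; apply: le_trans (nonexp_norm_le f (phi u) u) _.
  exact: le_trans qe.
apply/seteqP; split=> // h [/(ball_norm_le x0 p) + [_ /Lip_leP/(_ x0 p)]].
have gE u : val g u = val f (phi u) by [].
rewrite !gE phix0 phip => gh hb.
have : 2 * (gap / (1 + d) / 4 * e) <= gap * `|val x0 - val p|.
  have -> : 2 * (gap / (1 + d) / 4 * e) = gap * (e / 2 / (1 + d)).
    by field; rewrite gt_eqF//; lra.
  rewrite ler_pM2l// ler_pdivrMr; last by lra.
  by rewrite [leRHS]mulrC -pqx0.
move: fpq gh hb; rewrite pqx0 /gap.
set S := _ * (_ / _ / _ * e); lra.
Qed.

Lemma porous_Lip_le0 (u v : C) : u <> v ->
  porous [set f : nonexp_maps bC | (Lip (val f) <= 0)%E].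
Proof.
move=> uv f /= /Lip_leP f0.
have [D D0 CD] : exists2 D : R, 0 < D & forall x y : C, `|val x - val y| <= D.
  have [M [_ /(_ (`|M| + 1))]] := bC.
  rewrite (le_lt_trans (ler_norm _)) ?ltrDl// => /(_ isT) CM.
  exists (`|M| + 1 + (`|M| + 1)); first by have := normr_ge0 M; lra.
  move=> x y; rewrite (le_trans (ler_normB _ _))// lerD//; apply: CM;
  apply: set_mem; exact: valP.
have uv0 := norm_sub_gt0 uv.
(* With [t = e / D], points move by at most [t * D = e], and the images of [u] and [v] are
   [t * |u - v|] apart, twice the radius of the ball. Taking [e < D] keeps [t] below 1. *)
exists (`|val u - val v| / D / 2), D; split; rewrite ?divr_gt0// => e e0 eD.
pose t := e / D.
have t01 : 0 <= t <= 1.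
  by rewrite /t ler_pdivrMr// mul1r (ltW eD) andbT divr_ge0// ltW.
have /andP[t0 t1] := t01.
have [G GE] := choice (fun x => convex_point cvC (val f x) x t01).
have GB x y : val (G x) - val (G y) = t *: (val x - val y).
  have fxy : val (val f x) = val (val f y).
    apply/eqP; rewrite -subr_eq0 -normr_le0.
    by rewrite (le_trans (f0 x y)) ?mul0r.
  rewrite !GE fxy opprD addrACA subrr add0r -scalerBr; congr (_ *: _).
  by rewrite opprB addrA subrK.
have gP : (Lip G <= 1)%E.
  apply/Lip_leP => x y; rewrite GB normrZ ger0_norm//.
  by rewrite ler_wpM2r.
pose g : nonexp_maps bC := exist _ G gP.
exists g; split.
  apply: (mdist_le u) => x; rewrite /g/= GE addrC addKr normrZ ger0_norm//.
  by rewrite (le_trans (ler_wpM2l t0 (CD _ _)))// /t divfK ?gt_eqF.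
apply/seteqP; split=> // h [/(ball_norm_le u v) + /Lip_leP/(_ u v)].
have gE x : val g x = G x by [].
rewrite !gE GB normrZ ger0_norm// mul0r.
have -> : t * `|val u - val v| = 2 * (`|val u - val v| / D / 2 * e).
  by rewrite /t; field; rewrite gt_eqF.
by lra.
Qed.

End nonexpansive_maps.

(** * The countable decomposition *)

Theorem theorem2p1 (R : realType) (X : completeNormedModType R) (C : set X)
    (bC : bounded_set C) (clC : closed C)
    (cvC : convex_set (C : set (convex_lmodType X)))
    (ntC : exists x y, [/\ C x, C y & x <> y]) :
  sigma_porous [set f : nonexp_maps bC | (Lip (val f) < 1)%E].
Proof.
have [u [v uv]] : exists u v : C, u <> v.
  have [x [y [Cx Cy xy]]] := ntC.
  by exists (SigSub (mem_set Cx)), (SigSub (mem_set Cy)) => -[].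
(* The slack is d = (1 - b) / 2, for which b (1 + 2 d) = 1 - (1 - b)^2. *)
pose band (a b : R) := [set f : nonexp_maps bC |
  [/\ b < 1, b < a * (1 + (1 - b) / 2),
   (a%:E < Lip (val f))%E & (Lip (val f) <= b%:E)%E]].
(* Index 0 holds the constant maps, later ones the coded pairs of rationals. A pair violating the
   side conditions in [band] gives the empty set, which is porous. *)
pose A n := if n isn't m.+1 then [set f : nonexp_maps bC | (Lip (val f) <= 0)%E]
  else if unpickle m is Some (a, b) then band (ratr a) (ratr b) else set0.
exists A => [[|n]/=|].
- exact: porous_Lip_le0 uv.
- case: unpickle => [[a b] f [b1 ba fa fb]|f []].
  have d0 : 0 < (1 - ratr b) / 2 :> R by lra.
  have bd : ratr b * (1 + 2 * ((1 - ratr b) / 2)) <= 1 :> R.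
    by have := sqr_ge0 (1 - ratr b : R); rewrite expr2; lra.
  have [al [e [al0 e0 fA]]] := porous_Lip_band cvC d0 bd ba (conj fa fb).
  exists al, e; split=> // r r0 re; have [g [gf gA]] := fA r r0 re.
  exists g; split=> //; apply/seteqP; split=> // h [gh [_ _ ha hb]].
  by rewrite -gA; split.
apply/seteqP; split=> f /=; last first.
  move=> [[|n] _ /=]; first by move=> /le_lt_trans; apply; rewrite lte_fin.
  case: unpickle => [[a b]/= [b1 _ _ fb]|//].
  by rewrite (le_lt_trans fb)// lte_fin.
have [f0 _|f0 f1] := leP (Lip (val f)) 0%E; first by exists 0%N.
have [L LE] : exists L, Lip (val f) = L%:E.
  by exists (fine (Lip (val f))); rewrite fineK// fin_real// (lt_trans _ f0)//=
    (lt_trans f1)// ltry.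
move: f0 f1; rewrite LE !lte_fin => L0 L1.
(* The condition linking [a] and [b] reads [2 * b / (3 - b) < a]. It admits some [a < L] exactly
   when [b < 3 * L / (2 + L)], a bound above [L] because [0 < L < 1]. *)
have [|b] := @rat_in_itvoo _ L (3 * L / (2 + L)).
  by rewrite ltr_pdivlMr; nra.
rewrite in_itv/= => /andP[Lb]; rewrite ltr_pdivlMr; last by lra.
move=> bL.
have b1 : ratr b < 1 :> R by nra.
have [|a] := @rat_in_itvoo _ (2 * ratr b / (3 - ratr b)) L.
  by rewrite ltr_pdivrMr; lra.
rewrite in_itv/= => /andP[ba aL].
exists (pickle (a, b)).+1; first by [].
rewrite /A pickleK; split=> //; rewrite ?LE ?lte_fin ?lee_fin// ?(ltW Lb)//.
by move: ba; rewrite ltr_pdivrMr; lra.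
Qed.
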